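(* Consider the smooth threshold releases with function $h:\mathbb{R}\to[0,1]$ described in the context, at a point $z=(z_1,\dots,z_m)$ with $z_1<\cdots<z_m$ and $|z_k|\le R$. Suppose $h\in C^1$, $\operatorname{supp}(h')\subseteq[-b,b]$ for some $b>0$, $\|h'\|_\infty\le M$, and the thresholds $t_1<\cdots<t_L$ are placed on a regular grid over $[-R,R]$ with spacing $\eta_L$ satisfying $$\frac{c_1}{L}\le\eta_L\le\frac{c_2}{L}$$ for positive constants $c_1,c_2$ independent of $L$. Then: (i) The cumulative signal satisfies $\operatorname{tr}(\bm A_L(z))=O(L)$. (ii) Assume an identifiable stage exists, with first full-rank stage $L_{\mathrm{id}}:=\min\{L:\bm A_L(z)\succ\bm 0\}<\infty$. Then for every $L\ge L_{\mathrm{id}}$, $$\mathrm{CRB}_{\mathrm{unlab}}(L)=\Omega\!\left(\frac{\kappa_L}{L}\right).$$ Under uniform Basic Composition, this gives $$\mathrm{CRB}_{\mathrm{unlab}}(L)=\Omega(L\log L)\to\infty,$$ and hence the local CRB benchmark $\mathrm{CRB}_{\mathrm{unlab}}(L)$ has a finite budget-dependent optimum (a finite minimizing release count $L$) under the fixed-budget Basic-Composition calibration. With linear zCDP/RDP accounting, this generic lower bound is order-flat; any additional deterioration must come from weak geometry, not from the accountant plug-in alone.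
   Context: Threshold releases: for each number of releases $L$, the queries are $q_\ell(z)=\frac1m\sum_{k=1}^m h(z_k-t_\ell)$, $\ell=1,\dots,L$, where $h$ is a smooth approximation of a step function and $z$ is the sorted vector of the $m$ participating scalar records, assumed pairwise distinct. Each $q_\ell(z)$ is observed with independent Gaussian noise of variance $\kappa_L\Delta_{2,\ell}^2$, where $\Delta_{2,\ell}$ is the query's $\ell_2$-sensitivity, calibrated at the uniform bound $2/m$, and $\kappa_L>0$ is the noise penalty that the privacy accountant imposes when a fixed total privacy budget is shared by $L$ releases. Uniform Basic Composition with fixed total budget $(\varepsilon_{\mathrm{tot}},\delta_{\mathrm{tot}})$ means $\kappa_L=2L^2\ln(1.25L/\delta_{\mathrm{tot}})/\varepsilon_{\mathrm{tot}}^2=\Theta(L^2\log L)$; linear zCDP/RDP accounting (zero-concentrated or fixed-order Rényi differential privacy with the total budget split uniformly) means $\kappa_L=\Theta(L)$, and ''order-flat'' means that the bound $\kappa_L/L$ is then of constant order in $L$. With $\bm\psi_\ell(z):=(h'(z_1-t_\ell),\dots,h'(z_m-t_\ell))^\top$, the cumulative signal matrix is $$\bm A_L(z)=\frac14\sum_{\ell=1}^L\bm\psi_\ell(z)\bm\psi_\ell(z)^\top,$$ and the Fisher information matrix for the sorted vector $z$ is $\bm I_C(L)=\kappa_L^{-1}\bm A_L(z)$. The local benchmark is $\mathrm{CRB}_{\mathrm{unlab}}(L):=\operatorname{tr}(\bm I_C(L)^{-1})$, taken to be infinite when $\bm I_C(L)$ is singular. ''Geometry'' refers to the rank and conditioning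 (eigenvalues) of $\bm A_L(z)$, as opposed to the scalar accountant factor $\kappa_L$. *)

(* Defs.v *)
From HB Require Import structures.
From mathcomp Require Import all_boot all_order all_algebra.
From mathcomp Require Import all_classical all_reals all_analysis.

Set Implicit Arguments.
Unset Strict Implicit.
Unset Printing Implicit Defensive.

Import Order.TTheory GRing.Theory Num.Theory.
Import numFieldNormedType.Exports.

Local Open Scope classical_set_scope.
Local Open Scope ring_scope.

Section Definitions.
Context {R : realType}.

Definition C1 (h : R -> R) : Prop :=
  (forall x, derivable h x 1) /\ continuous (derive1 h).

(* Nothing is said about the end points, so that any placement convention
   (end points, cell midpoints, interior points) is covered. *)
Definition regular_grid (L : nat) (t : 'I_L -> R) (rad eta : R) : Prop :=
  (forall l, - rad <= t l <= rad) /\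
  (forall k l : 'I_L, l = k.+1 :> nat -> t l - t k = eta).

Definition signal_vec (m : nat) (h : R -> R) (z : 'I_m -> R) (s : R) :
  'cV[R]_m := \col_k derive1 h (z k - s).

(* t L : 'I_L -> R lists the L thresholds used when L releases are made; the
   threshold sets for different L need not be nested. *)
Definition signal_mx (m : nat) (h : R -> R) (z : 'I_m -> R)
    (t : forall L : nat, 'I_L -> R) (L : nat) : 'M[R]_m :=
  4^-1 *: \sum_(l < L) (signal_vec h z (t L l) *m (signal_vec h z (t L l))^T).

Definition posdef (m : nat) (A : 'M[R]_m) : Prop :=
  A^T = A /\ forall x : 'cV[R]_m, x != 0 -> 0 < (x^T *m A *m x) 0 0.

Definition first_full_rank_stage (m : nat) (A : nat -> 'M[R]_m) (Lid : nat) :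
  Prop :=
  [/\ (0 < Lid)%N, posdef (A Lid)
    & forall L, (0 < L)%N -> posdef (A L) -> (Lid <= L)%N].

(* The l-th query m^-1 * \sum_k h (z k - t l) has gradient m^-1 psi_l and noise
   variance kappa_L (2 / m)^2, hence it contributes
   (4 kappa_L)^-1 psi_l psi_l^T to the Fisher information. *)
Definition fisher_info (m : nat) (kappa : nat -> R) (A : nat -> 'M[R]_m)
    (L : nat) : 'M[R]_m :=
  (kappa L)^-1 *: A L.

Definition crb_unlab (m : nat) (kappa : nat -> R) (A : nat -> 'M[R]_m)
    (L : nat) : \bar R :=
  let I := fisher_info kappa A L in
  if I \in unitmx then (\tr (invmx I))%:E else +oo%E.

Definition basic_composition (eps delta : R) (L : nat) : R :=
  2 * L%:R ^+ 2 * ln (5 / 4 * L%:R / delta) / eps ^+ 2.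

(* kappa 0 is irrelevant: there is at least one release. *)
Definition noise_penalty (kappa : nat -> R) : Prop :=
  forall L, (0 < L)%N -> 0 < kappa L.

Definition linear_accounting (kappa : nat -> R) : Prop :=
  noise_penalty kappa /\ kappa \is 'Theta_\oo (fun L : nat => L%:R : R).

Definition unbounded_on (S : set nat) (u : nat -> \bar R) : Prop :=
  forall K : R, exists2 L, S L & (K%:E < u L)%E.

(* Along S, the smallest eigenvalue of A L is not bounded below by a positive
   multiple of L, the order of the largest possible trace; this includes rank
   deficiency (eigenvalue 0). *)
Definition weak_geometry_on (m : nat) (S : set nat) (A : nat -> 'M[R]_m) :
  Prop :=
  forall c : R, 0 < c ->
    exists2 L, S L & exists2 lam, eigenvalue (A L) lam & lam < c * L%:R.

End Definitions.

(* Main.v *)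
Require Import Defs.
From HB Require Import structures.
From mathcomp Require Import all_boot all_order all_algebra.
From mathcomp Require Import all_classical all_reals all_analysis.
From mathcomp Require Import zify ring lra.
Import Order.TTheory GRing.Theory Num.Theory.
Import numFieldNormedType.Exports.
Local Open Scope classical_set_scope.
Local Open Scope ring_scope.

(* Cauchy-Schwarz for the form x^T A x of an invertible positive semidefinite A,
   applied to x and to the columns of A^-1, gives |x|^2 <= tr (A^-1) x^T A x.
   With x a basis vector this is 1 <= tr (A^-1) tr A, and since
   tr A_L <= m M^2 L / 4 and CRB (L) = kappa_L tr (A_L^-1), the bound
   kappa_L / L follows; under Basic Composition it tends to infinity, so a
   minimum is attained among finitely many L.
   The same inequality yields the least eigenvalue without the spectral theorem:
   the largest a with A - a psd is an eigenvalue, as otherwise A - a would be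
   invertible and would dominate 1 / tr ((A - a)^-1). Finally A >= a > 0 gives
   (A^-1)_ii <= 1 / a, so under linear accounting an unbounded CRB forces small
   eigenvalues. *)

(** * Quadratic forms and the trace of the inverse *)

Section PositiveSemidefinite.
Context {R : realFieldType} {m : nat}.
Implicit Types (A : 'M[R]_m) (x y : 'cV[R]_m).

Definition qform A x : R := (x^T *m A *m x) 0 0.

Definition psd A : Prop := A^T = A /\ forall x, 0 <= qform A x.

Lemma qform_sub_scalar A x (a : R) :
  qform (A - a%:M) x = qform A x - a * \sum_i x i 0 ^+ 2.
Proof.
rewrite /qform mulmxBr mulmxBl mxE mul_mx_scalar -scalemxAl !mxE.
by congr (_ - a * _); apply: eq_bigr => i _; rewrite !mxE expr2.
Qed.

Lemma psd_sub_scalar A (a : R) : A^T = A ->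
  psd (A - a%:M) <-> forall x, a * \sum_i x i 0 ^+ 2 <= qform A x.
Proof.
move=> sA; split=> [[_ Ax] x|Ax].
  by have := Ax x; rewrite qform_sub_scalar subr_ge0.
split=> [|x]; first by rewrite linearB /= sA tr_scalar_mx.
by rewrite qform_sub_scalar subr_ge0.
Qed.

Lemma qform_sub A x y (s : R) : A^T = A ->
  qform A (y - s *: x) =
  qform A y - s * ((x^T *m (A *m y)) 0 0) *+ 2 + s ^+ 2 * qform A x.
Proof.
move=> sA; have sxy : (y^T *m A *m x) 0 0 = (x^T *m (A *m y)) 0 0.
  have -> : y^T *m A *m x = (x^T *m (A *m y))^T.
    by rewrite !trmx_mul trmxK sA.
  by rewrite mxE.
have txy : (y - s *: x)^T = y^T - s *: x^T by rewrite linearB linearZ.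
rewrite /qform txy !mulmxBl !mulmxBr -!scalemxAl -!scalemxAr.
have subE (B C : 'M[R]_1) : (B - C) 0 0 = B 0 0 - C 0 0 by rewrite !mxE.
have scaleE a (B : 'M[R]_1) : (a *: B) 0 0 = a * B 0 0 by rewrite mxE.
rewrite !(subE, scaleE) sxy mulmxA; ring.
Qed.

Lemma qform_delta A i : qform A (delta_mx i 0) = A i i.
Proof. by rewrite /qform trmx_delta -rowE -colE !mxE. Qed.

Lemma sum_sqr_delta (i : 'I_m) :
  \sum_j (delta_mx i 0 : 'cV[R]_m) j 0 ^+ 2 = 1.
Proof.
rewrite (bigD1 i) //= mxE !eqxx expr1n big1 ?addr0 // => j ji.
by rewrite mxE (negbTE ji) expr0n.
Qed.

Lemma mulmx_col_invmx A i : A \in unitmx ->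
  A *m col i (invmx A) = delta_mx i 0.
Proof. by move=> uA; rewrite colE mulmxA mulmxV // mul1mx. Qed.

Lemma qform_col_invmx A i : A \in unitmx ->
  qform A (col i (invmx A)) = invmx A i i.
Proof.
by move=> uA; rewrite /qform -mulmxA mulmx_col_invmx // -colE !mxE.
Qed.

Lemma psd_invmx_diag_ge0 A i : psd A -> A \in unitmx -> 0 <= invmx A i i.
Proof. by move=> [_ pA] uA; rewrite -qform_col_invmx. Qed.

Lemma psd_invmx_trace_ge0 A : psd A -> A \in unitmx -> 0 <= \tr (invmx A).
Proof. by move=> pA uA; apply: sumr_ge0 => i _; apply: psd_invmx_diag_ge0. Qed.

(* Cauchy-Schwarz for the form A, between x and the i-th column of A^-1. *)
Lemma psd_coord_sqr_le A x i : psd A -> A \in unitmx ->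
  x i 0 ^+ 2 <= invmx A i i * qform A x.
Proof.
move=> [sA pA] uA; have quad s :
    0 <= invmx A i i - s * x i 0 *+ 2 + s ^+ 2 * qform A x.
  have := pA (col i (invmx A) - s *: x).
  rewrite qform_sub // qform_col_invmx // mulmx_col_invmx //.
  by rewrite -colE !mxE.
have := pA x; rewrite le_eqVlt => /orP[/eqP q0|q_gt0].
  rewrite -q0 mulr0; have [->|xi0] := eqVneq (x i 0) 0; first by rewrite expr0n.
  (* With a vanishing form the quadratic is affine in [s]; this [s] gives it the value -1, so
     [x i 0] cannot be nonzero. *)
  have := quad ((invmx A i i + 1) / (2 * x i 0)).
  rewrite -q0 mulr0 addr0.
  suff -> : invmx A i i - (invmx A i i + 1) / (2 * x i 0) * x i 0 *+ 2 = -1.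
    by rewrite oppr_ge0 ler10.
  by field.
(* This [s] minimises the quadratic. *)
have := quad (x i 0 / qform A x).
have -> : invmx A i i - x i 0 / qform A x * x i 0 *+ 2 +
    (x i 0 / qform A x) ^+ 2 * qform A x =
    invmx A i i - x i 0 ^+ 2 / qform A x.
  by field; rewrite gt_eqF.
by rewrite subr_ge0 ler_pdivrMr.
Qed.

Lemma psd_sum_sqr_le A x : psd A -> A \in unitmx ->
  \sum_i x i 0 ^+ 2 <= \tr (invmx A) * qform A x.
Proof.
by move=> pA uA; rewrite mulr_suml; apply: ler_sum => i _;
  apply: psd_coord_sqr_le.
Qed.

Lemma psd_invmx_trace_gt0 A : (0 < m)%N -> psd A -> A \in unitmx ->
  0 < \tr (invmx A).
Proof.
move=> m0 pA uA; rewrite lt_neqAle psd_invmx_trace_ge0 // andbT.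
apply/eqP => tr0; have := psd_sum_sqr_le _ (delta_mx (Ordinal m0) 0) pA uA.
by rewrite sum_sqr_delta -tr0 mul0r ler10.
Qed.

Lemma psd_trace_mul_invmx_ge1 A : (0 < m)%N -> psd A -> A \in unitmx ->
  1 <= \tr (invmx A) * \tr A.
Proof.
move=> m0 pA uA; have := psd_sum_sqr_le _ (delta_mx (Ordinal m0) 0) pA uA.
rewrite sum_sqr_delta qform_delta => /le_trans; apply.
apply: ler_wpM2l; first exact: psd_invmx_trace_ge0.
rewrite /mxtrace (bigD1 (Ordinal m0)) //= lerDl sumr_ge0 // => i _.
by rewrite -qform_delta; apply: pA.2.
Qed.

(** Let d be the i-th diagonal entry of the inverse. The i-th column of the inverse has d as an
    entry and d as the value of its form, so testing A >= a on it gives a d^2 <= d, hence d <=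
    1/a. *)
Lemma psd_invmx_trace_le A (a : R) : 0 < a -> psd A -> A \in unitmx ->
  psd (A - a%:M) -> \tr (invmx A) <= m%:R / a.
Proof.
move=> a0 pA uA /(psd_sub_scalar _ _ pA.1) aA.
have -> : m%:R / a = \sum_(i < m) a^-1 by rewrite sumr_const card_ord mulr_natl.
apply: ler_sum => i _; rewrite -div1r ler_pdivlMr // mulrC.
have d0 : 0 <= invmx A i i by apply: psd_invmx_diag_ge0.
have : a * invmx A i i ^+ 2 <= invmx A i i.
  rewrite -{2}qform_col_invmx //; apply: le_trans (aA _).
  rewrite ler_pM2l // (bigD1 i) //= !mxE lerDl sumr_ge0 // => j _.
  exact: sqr_ge0.
move: d0; rewrite le_eqVlt => /orP[/eqP <- _|d0].
  by rewrite mulr0 ler01.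
by rewrite expr2 mulrA ger_pMl.
Qed.

Lemma eigenvalue_unitmx A (a : R) :
  eigenvalue A a = (A - a%:M \notin unitmx).
Proof. by rewrite /eigenvalue /eigenspace kermx_eq0 row_free_unit. Qed.

Lemma qform_gt0_unitmx A :
  (forall x, x != 0 -> 0 < qform A x) -> A \in unitmx.
Proof.
move=> pA; apply: contraT; rewrite -row_free_unit -kermx_eq0.
move=> /rowV0Pn[v /sub_kermxP vA v0].
have := pA v^T; rewrite trmx_eq0 => /(_ v0).
by rewrite /qform trmxK vA mul0mx mxE ltxx.
Qed.

End PositiveSemidefinite.

Lemma psd_least_eigenvalue {R : realType} {m : nat} (A : 'M[R]_m) :
  (0 < m)%N -> psd A -> exists2 a, eigenvalue A a & psd (A - a%:M).
Proof.
move=> m0 pA; have [sA qA] := pA.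
pose E : set R := [set a : R | forall x : 'cV[R]_m, a * \sum_i x i 0 ^+ 2 <= qform A x].
have E0 : E 0 by move=> x; rewrite mul0r.
have supE : has_sup E.
  split; first by exists 0.
  (* A basis vector bounds [E] by a diagonal entry; this needs [0 < m]. *)
  exists (A (Ordinal m0) (Ordinal m0)) => a /(_ (delta_mx (Ordinal m0) 0)).
  by rewrite sum_sqr_delta mulr1 qform_delta.
have psdE : psd (A - (sup E)%:M).
  apply/psd_sub_scalar => // x.
  have : 0 <= \sum_i x i 0 ^+ 2 by apply: sumr_ge0 => i _; apply: sqr_ge0.
  rewrite le_eqVlt => /orP[/eqP <-|N0]; first by rewrite mulr0.
  rewrite -ler_pdivlMr //; apply: ge_sup; first by exists 0.
  by move=> a /(_ x) Ea; rewrite ler_pdivlMr.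
exists (sup E) => //; rewrite eigenvalue_unitmx; apply/negP => uE.
have T0 := psd_invmx_trace_gt0 _ m0 psdE uE.
set T := \tr _ in T0.
(* Were [A - (sup E)%:M] invertible, Cauchy-Schwarz would bound its form below by [T^-1] times the
   squared norm, so [sup E] could be raised by [T^-1] within [E]. *)
suff /(sup_upper_bound supE) : E (sup E + T^-1).
  by rewrite gerDl leNgt invr_gt0 T0.
move=> x; have := psd_sum_sqr_le _ x psdE uE.
rewrite -/T qform_sub_scalar -ler_pdivrMl // => ?.
by rewrite mulrDl addrC -lerBrDr.
Qed.

(** * Positivity and trace of the cumulative signal *)

Section Signal.
Context {R : realType} {m : nat}.
Variables (h : R -> R) (z : 'I_m -> R) (t : forall L : nat, 'I_L -> R).

Lemma signal_mx_psd L : psd (signal_mx h z t L).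
Proof.
split=> [|x].
  rewrite /signal_mx linearZ /= raddf_sum; congr (_ *: _).
  by apply: eq_bigr => l _; rewrite /= trmx_mul trmxK.
rewrite /qform /signal_mx -scalemxAr -scalemxAl mxE mulr_ge0 //.
rewrite mulmx_sumr mulmx_suml summxE sumr_ge0 // => l _.
set v := signal_vec _ _ _.
(* Each release contributes the square of the scalar [x^T *m v]. *)
have -> : x^T *m (v *m v^T) *m x = (x^T *m v) *m (x^T *m v)^T.
  by rewrite trmx_mul trmxK !mulmxA.
by rewrite mxE big_ord1 [X in _ * X]mxE -expr2 sqr_ge0.
Qed.

(** Each rank-one term has trace equal to the sum of the [m] squared derivatives, each at most
    [M ^+ 2]. *)
Lemma signal_mx_trace_le (M : R) L : (forall x, `|derive1 h x| <= M) ->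
  \tr (signal_mx h z t L) <= (m%:R * M ^+ 2 / 4) * L%:R.
Proof.
move=> hM; rewrite /signal_mx mxtraceZ raddf_sum /=.
rewrite [leRHS]mulrAC [leRHS]mulrC ler_pM2l // mulr_natr.
have -> : m%:R * M ^+ 2 *+ L = \sum_(l < L) \sum_(k < m) M ^+ 2.
  by rewrite !sumr_const !card_ord mulr_natl.
apply: ler_sum => l _; apply: ler_sum => k _.
rewrite mxE big_ord1 !mxE -expr2 -real_normK ?num_real //.
by rewrite lerXn2r ?nnegrE // (le_trans _ (hM 0)).
Qed.

End Signal.

(** * The benchmark as a function of the noise penalty *)

Section CramerRao.
Context {R : realType} {m : nat}.
Implicit Types (kappa : nat -> R) (A : nat -> 'M[R]_m).

Lemma crb_unlabE kappa A L : 0 < kappa L ->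
  crb_unlab kappa A L =
  if A L \in unitmx then (kappa L * \tr (invmx (A L)))%:E else +oo%E.
Proof.
move=> k0; rewrite /crb_unlab /fisher_info.
have uk : (kappa L)^-1 \is a GRing.unit by rewrite unitfE invr_neq0 ?gt_eqF.
rewrite unitmxZ //; case: ifPn => // uA.
by rewrite invmxZ ?unitmxZ // invrK linearZ.
Qed.

Lemma crb_unlab_ge kappa A (T : R) L : (0 < m)%N -> 0 < T -> (0 < L)%N ->
  0 < kappa L -> psd (A L) -> \tr (A L) <= T * L%:R ->
  ((T^-1 * (kappa L / L%:R))%:E <= crb_unlab kappa A L)%E.
Proof.
move=> m0 T0 L0 k0 pA trA; rewrite crb_unlabE //; case: ifPn => [uA|_].
  rewrite lee_fin mulrCA -invfM ler_pM2l //.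
  have L0' : 0 < L%:R :> R by rewrite ltr0n.
  rewrite -div1r ler_pdivrMr ?mulr_gt0 //.
  apply: le_trans (psd_trace_mul_invmx_ge1 _ m0 pA uA) _.
  by apply: ler_wpM2l => //; apply: psd_invmx_trace_ge0.
exact: leey.
Qed.

(** Together with the scaling rule [crb_unlab_scale], this carries two-sided bounds on the penalty
    over to the benchmark, infinite values included. *)
Lemma crb_unlab_le kappa kappa' A L : psd (A L) ->
  0 < kappa L -> kappa L <= kappa' L ->
  (crb_unlab kappa A L <= crb_unlab kappa' A L)%E.
Proof.
move=> pA k0 kk'; rewrite !crb_unlabE ?(lt_le_trans k0) //.
by case: ifPn => // uA; rewrite lee_fin ler_wpM2r // psd_invmx_trace_ge0.
Qed.

Lemma crb_unlab_scale (a : R) kappa A L : 0 < a -> 0 < kappa L ->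
  (a%:E * crb_unlab kappa A L)%E = crb_unlab (fun n => a * kappa n) A L.
Proof.
move=> a0 k0; rewrite !crb_unlabE ?mulr_gt0 //; case: ifPn => _.
  by rewrite -EFinM mulrA.
by rewrite gt0_muley ?lte_fin.
Qed.

End CramerRao.

(** Only finitely many positive indices precede the asymptotic range, and each has a positive ratio
    [u L / v L] that the constants can absorb. *)
Lemma Theta_uniform {R : realType} (u v : nat -> R) :
  (forall L, (0 < L)%N -> 0 < u L) -> (forall L, (0 < L)%N -> 0 < v L) ->
  u \is 'Theta_\oo v ->
  exists a a' : R, [/\ 0 < a, 0 < a' &
    forall L, (0 < L)%N -> a * v L <= u L <= a' * v L].
Proof.
move=> u0 v0; rewrite qualifE => /asboolP[[k1 k2] /= /andP[k10 k20]].
move=> [N _ uv].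
(* The start of the range is lowered from [N] one index at a time. *)
suff: forall n, (n <= N)%N -> exists a a' : R, [/\ 0 < a, 0 < a' &
    forall L, (0 < L)%N -> (N - n <= L)%N -> a * v L <= u L <= a' * v L].
  move=> /(_ N (leqnn N))[a [a' [a0 a'0 H]]]; exists a, a'; split => // L L0.
  by apply: H => //; rewrite subnn.
elim=> [_|n IHn nN].
  exists k1, k2; split => // L L0; rewrite subn0 => /uv /=.
  by rewrite !gtr0_norm ?u0 ?v0 // => -[-> ->].
have [a [a' [a0 a'0 H]]] := IHn (ltnW nN).
(* If the new index is 0, it is excluded by [0 < L] and the old constants serve. *)
have [Nn0|Nn0] := posnP (N - n.+1)%N.
  exists a, a'; split => // L L0 _; apply: H => //; lia.
set r := u (N - n.+1)%N / v (N - n.+1)%N.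
have r0 : 0 < r by rewrite divr_gt0 ?u0 ?v0.
exists (Num.min a r), (Num.max a' r); split => [||L L0].
- by rewrite lt_min a0.
- by rewrite lt_max a'0.
rewrite leq_eqVlt => /orP[/eqP <-|NL].
  rewrite -[X in _ <= X <= _](divfK (lt0r_neq0 (v0 _ Nn0))).
  by rewrite !ler_pM2r ?v0 // ge_min le_max lexx !orbT.
have /andP[aL La'] := H _ L0 (ltac:(lia)).
have vL := v0 _ L0.
apply/andP; split.
  by apply: le_trans aL; rewrite ler_pM2r // ge_min lexx.
by apply: le_trans La' _; rewrite ler_pM2r // le_max lexx.
Qed.

(** * Growth of the Basic Composition penalty *)

Section BasicComposition.
Context {R : realType}.
Variables (eps delta : R).
Hypotheses (eps0 : 0 < eps) (delta01 : 0 < delta < 1).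

(** The part of the logarithm independent of [L]. Its positivity keeps the penalty positive at
    [L = 1], where [ln L%:R] vanishes. *)
Let C : R := ln (5 / 4 / delta).

Let C_gt0 : 0 < C.
Proof.
have /andP[d0 d1] := delta01.
by apply: ln_gt0; rewrite ltr_pdivlMr // mul1r; lra.
Qed.

Lemma basic_compositionE L : (0 < L)%N ->
  basic_composition eps delta L = 2 / eps ^+ 2 * (L%:R ^+ 2 * (ln L%:R + C)).
Proof.
move=> L0; have /andP[d0 d1] := delta01.
rewrite /basic_composition.
have -> : 5 / 4 * L%:R / delta = L%:R * (5 / 4 / delta) by ring.
rewrite lnM ?posrE ?ltr0n ?divr_gt0 // -/C; ring.
Qed.

Lemma basic_composition_ge L : (0 < L)%N ->
  2 / eps ^+ 2 * (L%:R ^+ 2 * ln L%:R) <= basic_composition eps delta L.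
Proof.
move=> L0; rewrite basic_compositionE // ler_pM2l ?divr_gt0 ?exprn_gt0 //.
by rewrite ler_pM2l ?exprn_gt0 ?ltr0n // lerDl ltW.
Qed.

Lemma basic_composition_gt0 : noise_penalty (basic_composition eps delta).
Proof.
move=> L L0; rewrite basic_compositionE //.
rewrite !mulr_gt0 ?invr_gt0 ?exprn_gt0 ?ltr0n //.
by rewrite ltr_wpDl // ln_ge0 // ler1n.
Qed.

Lemma basic_composition_Theta : basic_composition eps delta \is
  'Theta_\oo (fun L : nat => L%:R ^+ 2 * ln (L%:R : R)).
Proof.
have ln2 : 0 < ln 2 :> R by rewrite ln_gt0 // ltr1n.
have e0 : 0 < 2 / eps ^+ 2 by rewrite divr_gt0 ?exprn_gt0.
rewrite qualifE; apply/asboolP.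
(* For [L >= 2] the constant [C] is at most [C / ln 2 * ln L%:R]; the range starts at 2 because
   [ln 1 = 0]. *)
exists (2 / eps ^+ 2, 2 / eps ^+ 2 * (1 + C / ln 2)) => /=.
  by rewrite e0 mulr_gt0 // ltr_wpDl // divr_gt0.
exists 2%N => // L /= L2; have L0 : (0 < L)%N by apply: ltnW.
have lnL : ln 2 <= ln L%:R :> R by rewrite ler_ln ?posrE ?ltr0n // ler_nat.
have L20 : 0 < L%:R ^+ 2 :> R by rewrite exprn_gt0 ?ltr0n.
rewrite (gtr0_norm (basic_composition_gt0 _ L0)) ger0_norm; last first.
  by rewrite mulr_ge0 ?ltW // (lt_le_trans ln2).
split; first exact: basic_composition_ge.
rewrite basic_compositionE // -[leRHS]mulrA ler_pM2l // [leRHS]mulrCA.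
rewrite ler_pM2l //.
rewrite mulrDl mul1r lerD2l -mulrA ler_peMr ?(ltW C_gt0) //.
by rewrite mulrC ler_pdivlMr ?mul1r.
Qed.

End BasicComposition.

Lemma attains_min {R : realType} (u : nat -> \bar R) (n : nat) :
  (forall L, u L != -oo%E) -> (0 < n)%N -> u n \is a fin_num ->
  u L @[L --> \oo] --> +oo%E ->
  exists k, [/\ (0 < k)%N, u k \is a fin_num
    & forall L, (0 < L)%N -> (u k <= u L)%E].
Proof.
(* From [N] on the values are at least [u n], so it suffices to minimise over the positive indices
   up to [N + n], among which is [n]. *)
move=> uNy n0 un /cvgey_ge /(_ (fine (u n)))[N _ uN].
have nNn : (n < (N + n).+1)%N by rewrite ltnS leq_addl.
case: (@arg_minP _ _ _ (Ordinal nNn) (fun i => (0 < i)%N) (fun i => u i)) => //.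
move=> i i0 min_i; have uin : (u i <= u n)%E by apply: (min_i (Ordinal nNn)).
exists i; split => //.
  by rewrite fin_numE uNy /= -ltey (le_lt_trans uin) // ltey_eq un.
move=> L L0; have [LNn|NnL] := ltnP L (N + n).+1; first exact: (min_i (Ordinal LNn)).
apply: le_trans uin _; rewrite -(fineK un); apply: uN => /=.
exact: leq_trans (leq_addr n N) (ltnW NnL).
Qed.

(** * Trace growth, lower bounds and the two accountants *)

Theorem proposition6 (R : realType) (m : nat) (m_gt0 : (0 < m)%N)
    (rad b M c1 c2 : R) (h : R -> R) (z : 'I_m -> R)
    (t : forall L : nat, 'I_L -> R) (eta : nat -> R)
    (h01 : forall x, 0 <= h x <= 1)
    (hC1 : C1 h)
    (b_gt0 : 0 < b)
    (hsupp : closure [set x | derive1 h x != 0] `<=` [set x | - b <= x <= b])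
    (hM : forall x, `|derive1 h x| <= M)
    (z_sorted : forall i j : 'I_m, (i < j)%N -> z i < z j)
    (z_bound : forall k, `|z k| <= rad)
    (c1_gt0 : 0 < c1) (c2_gt0 : 0 < c2)
    (t_incr : forall L (k l : 'I_L), (k < l)%N -> t L k < t L l)
    (t_grid : forall L, (0 < L)%N -> regular_grid (t L) rad (eta L))
    (eta_bound : forall L, (0 < L)%N -> c1 / L%:R <= eta L <= c2 / L%:R) :
  let A := signal_mx h z t in
  (* (i) *)
  (fun L : nat => \tr (A L)) =O_\oo (fun L : nat => L%:R : R)
  /\
  (* (ii) *)
  (forall Lid : nat, first_full_rank_stage A Lid ->
   [/\ (* generic lower bound *)
       exists2 c : R, 0 < c &
         forall kappa, noise_penalty kappa ->
         forall L, (Lid <= L)%N ->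
           ((c * (kappa L / L%:R))%:E <= crb_unlab kappa A L)%E,
       (* uniform Basic Composition *)
       forall eps delta : R, 0 < eps -> 0 < delta < 1 ->
         let kappa := basic_composition eps delta in
         [/\ kappa \is 'Theta_\oo (fun L : nat => L%:R ^+ 2 * ln (L%:R : R)),
             exists2 c : R, 0 < c & forall L, (Lid <= L)%N ->
               ((c * (L%:R * ln L%:R))%:E <= crb_unlab kappa A L)%E,
             crb_unlab kappa A L @[L --> \oo] --> +oo%E
           & exists Lopt : nat,
               [/\ (0 < Lopt)%N, (crb_unlab kappa A Lopt \is a fin_num)
                 & forall L, (0 < L)%N ->
                     (crb_unlab kappa A Lopt <= crb_unlab kappa A L)%E]]
     & (* linear accounting *)
       forall kappa, linear_accounting kappa ->
         [/\ (* the generic bound is order-flat *)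
             (fun L : nat => kappa L / L%:R) \is 'Theta_\oo (fun=> 1 : R),
             (* up to constants the benchmark is the accountant-free trace of
                the inverse of L^-1 A_L *)
             exists a a' : R, [/\ 0 < a, 0 < a' & forall L, (0 < L)%N ->
               (a%:E * crb_unlab (fun n => n%:R) A L <= crb_unlab kappa A L
                <= a'%:E * crb_unlab (fun n => n%:R) A L)%E]
           & (* unbounded growth forces weak geometry *)
             forall S : set nat, S `<=` [set L | (0 < L)%N] ->
               unbounded_on S (crb_unlab kappa A) -> weak_geometry_on S A]]).
Proof.
move=> A.
have pA L : psd (A L) by apply: signal_mx_psd.
(* The added 1 keeps [T] positive, hence invertible, even when [M = 0]. *)
pose T : R := m%:R * (M ^+ 2 + 1) / 4.
have T0 : 0 < T by rewrite !mulr_gt0 ?ltr0n // ltr_wpDl ?sqr_ge0.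
have trA L : \tr (A L) <= T * L%:R.
  apply: le_trans (signal_mx_trace_le _ _ _ _ _ hM) _.
  by rewrite ler_wpM2r // ler_pM2r ?invr_gt0 // ler_pM2l ?ltr0n // lerDl.
have trA0 L : 0 <= \tr (A L).
  by apply: sumr_ge0 => i _; rewrite -qform_delta; apply: (pA L).2.
have generic kappa L : noise_penalty kappa -> (0 < L)%N ->
    ((T^-1 * (kappa L / L%:R))%:E <= crb_unlab kappa A L)%E.
  by move=> k0 L0; apply: crb_unlab_ge (k0 L L0) (pA L) (trA L).
split.
  apply/eqO_exP; exists T => //; apply: nearW => L.
  by rewrite !ger0_norm.
move=> Lid [Lid0 Lid_pd _]; split.
- exists T^-1; first by rewrite invr_gt0.
  by move=> kappa k0 L LidL; apply: generic => //; apply: leq_trans LidL.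
- move=> eps delta eps0 delta01 kappa.
  have kappa0 : noise_penalty kappa by apply: basic_composition_gt0.
  pose c := T^-1 * (2 / eps ^+ 2).
  have c0 : 0 < c by rewrite mulr_gt0 ?divr_gt0 ?invr_gt0 ?exprn_gt0.
  have crb_ge L : (0 < L)%N ->
      ((c * (L%:R * ln L%:R))%:E <= crb_unlab kappa A L)%E.
    move=> L0; apply: le_trans (generic kappa L kappa0 L0).
    have L0' : 0 < L%:R :> R by rewrite ltr0n.
    rewrite lee_fin -mulrA ler_pM2l ?invr_gt0 // ler_pdivlMr //.
    apply: le_trans (basic_composition_ge _ _ eps0 delta01 _ L0).
    by rewrite -(mulrA (2 / _)) (mulrAC L%:R) -expr2.
  have crb_cvg : crb_unlab kappa A L @[L --> \oo] --> +oo%E.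
    apply/cvgeyPge => K.
    have ln2 : 0 < ln 2 :> R by rewrite ln_gt0 // ltr1n.
    (* For [L >= 2] the lower bound is at least [c * ln 2 * L%:R]. *)
    have : \forall L \near \oo, K / (c * ln 2) <= L%:R by exact: nbhs_infty_ger.
    apply: filterS2 (nbhs_infty_ge 2) => L L2 KL.
    have L0 : (0 < L)%N by apply: ltnW.
    apply: le_trans (crb_ge L L0); rewrite lee_fin.
    move: KL; rewrite (ler_pdivrMr _ _ (mulr_gt0 c0 ln2)) => /le_trans; apply.
    rewrite mulrCA (ler_pM2l c0) ler_pM2l ?ltr0n //.
    by rewrite ler_ln ?posrE ?ltr0n // ler_nat.
  split => //.
  + exact: basic_composition_Theta.
  + exists c => // L LidL; apply: crb_ge; exact: leq_trans LidL.
  (* Stage [Lid] supplies the finite value: a positive definite signal is invertible. *)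
  + apply: (attains_min _ Lid) => // [L|].
      by rewrite /crb_unlab; case: ifP.
    by rewrite crb_unlabE ?kappa0 // (qform_gt0_unitmx (A Lid) Lid_pd.2).
- move=> kappa [kappa0 kappaT].
  have L0 L : (0 < L)%N -> 0 < L%:R :> R by rewrite ltr0n.
  have [a [a' [a0 a'0 H]]] := Theta_uniform _ _ kappa0 L0 kappaT.
  have crb_le L : (0 < L)%N ->
      (crb_unlab kappa A L <= a'%:E * crb_unlab (fun n => n%:R) A L)%E.
    move=> /[dup] Lgt0 /H/andP[_ ?].
    by rewrite crb_unlab_scale ?L0 // crb_unlab_le // kappa0.
  split.
  + rewrite qualifE; apply/asboolP; exists (a, a') => /=; first by rewrite a0.
    exists 1%N => // L /= Lgt0; rewrite normr1 !mulr1.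
    rewrite gtr0_norm ?divr_gt0 ?kappa0 ?L0 //.
    by rewrite ler_pdivlMr ?ler_pdivrMr ?L0 //; apply/andP; apply: H.
  + exists a, a'; split => // L Lgt0; rewrite crb_le // andbT.
    have /andP[aL _] := H L Lgt0.
    by rewrite crb_unlab_scale ?L0 // crb_unlab_le // mulr_gt0 // L0.
  + move=> S S0 unb c c0; apply: contrapT => noS.
    (* If all eigenvalues along [S] were at least [c * L%:R], the trace of the inverse would be at
       most [m%:R / (c * L%:R)]; multiplied by the penalty bound [a' * L%:R], this gives the value
       that [L] is chosen to exceed. *)
    have [L SL] := unb (a' * (m%:R / c)).
    have Lgt0 := S0 L SL; apply/negP; rewrite -leNgt.
    have cL0 : 0 < c * L%:R by rewrite mulr_gt0 // L0.
    have eigA lam : eigenvalue (A L) lam -> c * L%:R <= lam.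
      by move=> elam; rewrite leNgt; apply/negP => lt_lam; apply: noS;
        exists L => //; exists lam.
    (* Singularity would make 0 an eigenvalue below [c * L%:R], so the infinite branch of the
       benchmark is excluded. *)
    have uA : A L \in unitmx.
      apply: contraT => nuA; have := eigA 0; rewrite eigenvalue_unitmx.
      by rewrite raddf0 subr0 nuA => /(_ isT); rewrite leNgt cL0.
    have [lam /eigA c_lam psd_lam] := psd_least_eigenvalue _ m_gt0 (pA L).
    apply: le_trans (crb_le L Lgt0) _.
    rewrite crb_unlabE ?L0 // uA -EFinM lee_fin ler_pM2l //.
    have lam0 : 0 < lam by apply: lt_le_trans c_lam.
    rewrite mulrC -ler_pdivlMr ?L0 // -mulrA -invfM.
    apply: le_trans (psd_invmx_trace_le _ _ lam0 (pA L) uA psd_lam) _.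
    by rewrite ler_wpM2l // lef_pV2.
Qed.
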